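(* Let $\Sigma$ be a finite poset. For $n\ge1$ let $End_{I_\Sigma,S_\Sigma}(n)$ be the space of $S_\Sigma$-bimodule morphisms from $I_\Sigma^{\otimes n}$ to $I_\Sigma$ that factorize through $I_\Sigma^{\otimes_{S_\Sigma}n}$. The family $(End_{I_\Sigma,S_\Sigma}(n))_{n\ge1}$ is a suboperad of the endomorphism operad $\mathcal L_{I_\Sigma}$.
   Context: $\mathbb K$ is an arbitrary field; unadorned tensor products are over $\mathbb K$. Operads are nonsymmetric operads of $\mathbb K$-vector spaces, indexed by arities $n\ge1$, with a unit in arity $1$; a suboperad is a family of linear subspaces containing the unit and stable under the compositions. The endomorphism operad $\mathcal L_V$ of a vector space $V$ is $\mathcal L_V(n)=\mathrm{Hom}_{\mathbb K}(V^{\otimes n},V)$, with composition $\gamma(f;f_1,\dots,f_k)=f\circ(f_1\otimes\cdots\otimes f_k)$ and unit $\mathrm{id}_V$. The incidence algebra $I_\Sigma$ is the unital associative $\mathbb K$-algebra with linear basis the pairs $(\sigma,\sigma')$, $\sigma\le\sigma'$ in $\Sigma$, and product $(\sigma,\sigma')(\beta,\beta')=(\sigma,\beta')$ if $\sigma'=\beta$ and $0$ otherwise. $S_\Sigma\subset I_\Sigma$ is the commutative unital subalgebra spanned by the $(\sigma,\sigma)$. The $S_\Sigma$-bimodule structure of $I_\Sigma^{\otimes n}$ is given by left multiplication on the first tensor factor and right multiplication on the last one. $I_\Sigma^{\otimes_{S_\Sigma}n}$ is the $n$-fold tensor product over $S_\Sigma$. ''Factorizes through $I_\Sigma^{\otimes_{S_\Sigma}n}$''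 means that $\mu:I_\Sigma^{\otimes n}\to I_\Sigma$ is a composite $I_\Sigma^{\otimes n}\to I_\Sigma^{\otimes_{S_\Sigma}n}\to I_\Sigma$ whose first map is the canonical projection. *)

(* Defs.v *)
From HB Require Import structures.
From mathcomp Require Import all_boot all_order all_algebra.
From mathcomp Require Import boolp classical_sets.
From mathcomp Require Import freeg.

Set Implicit Arguments.
Unset Strict Implicit.
Unset Printing Implicit Defensive.

Import Order.TTheory GRing.Theory.
Import Quotient.
Local Open Scope ring_scope.
Local Open Scope classical_set_scope.
Local Open Scope quotient_scope.

Section Subspace.
Context {K : fieldType} {V : lmodType K}.

Definition subspace (P : set V) : Prop :=
  P 0 /\ forall (a : K) (x y : V), P x -> P y -> P (a *: x + y).

Definition lspan (X : set V) : set V := smallest subspace X.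

Lemma subspace_lspan X : subspace (lspan X).
Proof.
split=> [P [[P0 _] _] //|a x y Px Py P hP].
by case: (hP) => [[_ PD] _]; apply: PD; [apply: Px|apply: Py].
Qed.

Lemma sub_lspan X : X `<=` lspan X.
Proof. by move=> x Xx P [_]; apply. Qed.

End Subspace.

Section Hom.
Context {K : fieldType}.

Definition hom (U V : lmodType K) : Type := {linear U -> V}.
Identity Coercion linear_of_hom : hom >-> GRing.Linear.type.

Context {U V : lmodType K}.
Implicit Types f g h : hom U V.

Lemma homP f g : (forall x, f x = g x) -> f = g.
Proof.
move=> /funext; case: f g => [f cf] [g cg] /= fg.
subst g; congr GRing.Linear.Pack.
case: cf cg => [[a] [b]] [[a'] [b']]; congr GRing.Linear.Class;
  [congr GRing.isNmodMorphism.Axioms_|congr GRing.isScalable.Axioms_];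
  exact: Prop_irrelevance.
Qed.

HB.instance Definition _ := gen_eqMixin (hom U V).
HB.instance Definition _ := gen_choiceMixin (hom U V).

Definition hom_zero : hom U V := \0 : {linear U -> V}.
Definition hom_opp f : hom U V := \- f : {linear U -> V}.
Definition hom_add f g : hom U V := f \+ g : {linear U -> V}.
Definition hom_scale (a : K) f : hom U V := a \*: f : {linear U -> V}.

Fact hom_addA : associative hom_add.
Proof. by move=> f g h; apply: homP => x; rewrite /= addrA. Qed.
Fact hom_addC : commutative hom_add.
Proof. by move=> f g; apply: homP => x; rewrite /= addrC. Qed.
Fact hom_add0 : left_id hom_zero hom_add.
Proof. by move=> f; apply: homP => x; rewrite /= add0r. Qed.
Fact hom_addN : left_inverse hom_zero hom_opp hom_add.
Proof. by move=> f; apply: homP => x; rewrite /= addNr. Qed.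

HB.instance Definition _ :=
  GRing.isZmodule.Build (hom U V) hom_addA hom_addC hom_add0 hom_addN.

Fact hom_scaleA a b f : hom_scale a (hom_scale b f) = hom_scale (a * b) f.
Proof. by apply: homP => x; rewrite /= scalerA. Qed.
Fact hom_scale1 : left_id 1 hom_scale.
Proof. by move=> f; apply: homP => x; rewrite /= scale1r. Qed.
Fact hom_scaleDr : right_distributive hom_scale +%R.
Proof. by move=> a f g; apply: homP => x; rewrite /= scalerDr. Qed.
Fact hom_scaleDl f a b : hom_scale (a + b) f = hom_scale a f + hom_scale b f.
Proof. by apply: homP => x; rewrite /= scalerDl. Qed.

HB.instance Definition _ := GRing.Zmodule_isLmodule.Build K (hom U V)
  hom_scaleA hom_scale1 hom_scaleDr hom_scaleDl.

Lemma hom0E x : (0 : hom U V) x = 0. Proof. by []. Qed.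
Lemma homDE f g x : (f + g) x = f x + g x. Proof. by []. Qed.
Lemma homZE (a : K) f x : (a *: f) x = a *: f x. Proof. by []. Qed.

End Hom.

Section LinearQuotient.
Context {K : fieldType} {V : lmodType K} (X : set V).

Definition lspan_pred : {pred V} := fun v => `[< lspan X v >].

Fact lspan_pred_submod : submod_closed lspan_pred.
Proof.
have [h0 hD] := subspace_lspan X.
split=> [|a x y /asboolP hx /asboolP hy]; apply/asboolP => //.
exact: hD.
Qed.

HB.instance Definition _ :=
  GRing.isSubmodClosed.Build K V lspan_pred lspan_pred_submod.

(* The quotient of V by the subspace spanned by X. *)
Definition lquot : Type := {quot lspan_pred}.
HB.instance Definition _ := GRing.Zmodule.on lquot.
HB.instance Definition _ : EqQuotient V _ lquot := EqQuotient.on lquot.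

Fact lquot_eqP (x y : V) : reflect (\pi_lquot x = \pi_lquot y) (x - y \in lspan_pred).
Proof. by rewrite idealrBE; exact: eqP. Qed.

Definition lquot_scale (a : K) (q : lquot) : lquot := \pi_lquot (a *: repr q).

Fact pi_lquotD (x y : V) : \pi_lquot (x + y) = \pi_lquot x + \pi_lquot y.
Proof. by rewrite [RHS]piE. Qed.

Fact pi_lquotZ a (x : V) : \pi_lquot (a *: x) = lquot_scale a (\pi_lquot x).
Proof.
apply/lquot_eqP; rewrite -scalerBr rpredZ//.
by apply/lquot_eqP; rewrite reprK.
Qed.

Fact lquotW (P : lquot -> Prop) : (forall x, P (\pi_lquot x)) -> forall q, P q.
Proof. by move=> h q; rewrite -[q]reprK. Qed.

Fact lquot_scaleA a b q : lquot_scale a (lquot_scale b q) = lquot_scale (a * b) q.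
Proof. by elim/lquotW: q => x; rewrite -!pi_lquotZ scalerA. Qed.
Fact lquot_scale1 : left_id 1 lquot_scale.
Proof. by move=> q; elim/lquotW: q => x; rewrite -pi_lquotZ scale1r. Qed.
Fact lquot_scaleDr : right_distributive lquot_scale +%R.
Proof.
move=> a p q; elim/lquotW: p => x; elim/lquotW: q => y.
by rewrite -pi_lquotD -!pi_lquotZ scalerDr pi_lquotD.
Qed.
Fact lquot_scaleDl q a b : lquot_scale (a + b) q = lquot_scale a q + lquot_scale b q.
Proof. by elim/lquotW: q => x; rewrite -!pi_lquotZ -pi_lquotD scalerDl. Qed.

HB.instance Definition _ := GRing.Zmodule_isLmodule.Build K lquot
  lquot_scaleA lquot_scale1 lquot_scaleDr lquot_scaleDl.

Definition lquot_pi_fun (x : V) : lquot := \pi_lquot x.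
Fact lquot_pi_is_linear : linear lquot_pi_fun.
Proof. by move=> a x y; rewrite /lquot_pi_fun pi_lquotD pi_lquotZ. Qed.
HB.instance Definition _ :=
  GRing.isLinear.Build K V lquot _ lquot_pi_fun lquot_pi_is_linear.
Definition lquot_pi : hom V lquot := lquot_pi_fun.

Lemma lquot_pi_surj q : exists x, lquot_pi x = q.
Proof. by exists (repr q); exact: reprK. Qed.

Lemma lquot_pi_eq0 x : lquot_pi x = 0 <-> lspan X x.
Proof.
rewrite -(raddf0 lquot_pi) -[x in lspan _ x]subr0.
by split=> [/lquot_eqP/asboolP|/asboolP/lquot_eqP].
Qed.

Section Lift.
Context {W : lmodType K} (f : hom V W) (f0 : forall x, X x -> f x = 0).

Definition lquot_lift_fun (q : lquot) : W := f (repr q).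

Fact lquot_lift_funE x : lquot_lift_fun (lquot_pi x) = f x.
Proof.
suff /(_ (repr (lquot_pi x) - x)) h : lspan X `<=` [set y | f y = 0].
  apply/eqP; rewrite -subr_eq0 -raddfB; apply/eqP/h/lquot_pi_eq0.
  by rewrite raddfB /= /lquot_pi_fun reprK subrr.
move=> y; apply; split=> //; split=> [|a u v /= fu fv]; first exact: raddf0.
by rewrite linearP fu fv scaler0 addr0.
Qed.

Fact lquot_lift_is_linear : linear lquot_lift_fun.
Proof.
move=> a p q; have [x <-] := lquot_pi_surj p; have [y <-] := lquot_pi_surj q.
by rewrite -linearP !lquot_lift_funE linearP.
Qed.

Definition lquot_lift : hom lquot W :=
  HB.pack lquot_lift_fun
    (GRing.isLinear.Build K lquot W _ lquot_lift_fun lquot_lift_is_linear).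

Lemma lquot_liftE x : lquot_lift (lquot_pi x) = f x.
Proof. exact: lquot_lift_funE. Qed.

End Lift.
End LinearQuotient.

Section TensorPower.
Context {K : fieldType}.

Definition upd {n : nat} {V : choiceType} (v : {ffun 'I_n -> V}) (i : 'I_n) (x : V)
  : {ffun 'I_n -> V} := [ffun j => if j == i then x else v j].

Section Def.
Context {n : nat} {V : lmodType K}.

Definition multilinear {W : lmodType K} (phi : {ffun 'I_n -> V} -> W) : Prop :=
  forall v i (a : K) (x y : V),
    phi (upd v i (a *: x + y)) = a *: phi (upd v i x) + phi (upd v i y).

Definition tpow_rel : set {freeg {ffun 'I_n -> V} / K} :=
  [set r | exists v i (a : K) (x y : V),
    r = << upd v i (a *: x + y) >> - (a *: << upd v i x >> + << upd v i y >>)].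

End Def.

(* V^{(x) n}, as the free vector space on V^n modulo multilinearity. *)
Definition tpow (n : nat) (V : lmodType K) : lmodType K := lquot (@tpow_rel n V).

Context {n : nat} {V : lmodType K}.

(* v_0 (x) ... (x) v_{n-1} *)
Definition pure (v : {ffun 'I_n -> V}) : tpow n V := lquot_pi tpow_rel << v >>.

Lemma pure_multilinear : multilinear pure.
Proof.
move=> v i a x y; apply/eqP; rewrite -linearP -subr_eq0 -raddfB.
by apply/eqP/lquot_pi_eq0; apply: sub_lspan; exists v, i, a, x, y.
Qed.

Section Lift.
Context {W : lmodType K} (phi : {ffun 'I_n -> V} -> W).

Fact fglift_is_linear : linear (fglift phi : {freeg {ffun 'I_n -> V} / K} -> W).
Proof.
have fgB := @lift_is_additive K _ W phi.
have fg0 : fglift phi 0 = 0 by rewrite -(subrr 0) fgB subrr.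
have fgD x y : fglift phi (x + y) = fglift phi x + fglift phi y.
  by rewrite -[y in LHS]opprK fgB -[- y]sub0r fgB fg0 sub0r opprK.
have fgS (I : eqType) (r : seq I) (F : I -> {freeg {ffun 'I_n -> V} / K}) :
    fglift phi (\sum_(z <- r) F z) = \sum_(z <- r) fglift phi (F z).
  exact: (big_morph _ fgD fg0).
move=> a x y; rewrite fgD; congr (_ + _).
rewrite -[x]freeg_sumE scaler_sumr !fgS scaler_sumr.
apply: eq_bigr => v _; rewrite liftU scalerA -(liftU phi).
suff -> : a *: << coeff v x *g v >> = << a * coeff v x *g v >> by [].
by apply/eqP/freeg_eqP => w; rewrite coeffZ !coeffU mulrA.
Qed.

Definition free_lift : hom {freeg {ffun 'I_n -> V} / K} W :=
  HB.pack (fglift phi : {freeg {ffun 'I_n -> V} / K} -> W)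
    (GRing.isLinear.Build K _ W _ _ fglift_is_linear).

Lemma free_liftE v : free_lift << v >> = phi v.
Proof. by rewrite /= liftU scale1r. Qed.

Hypothesis phi_lin : multilinear phi.

Fact free_lift_rel r : tpow_rel r -> free_lift r = 0.
Proof.
move=> [v [i [a [x [y ->]]]]].
by rewrite linearB linearP !free_liftE phi_lin subrr.
Qed.

(* The linear map on V^{(x) n} induced by the multilinear map phi. *)
Definition tlift : hom (tpow n V) W := lquot_lift free_lift_rel.

Lemma tliftE v : tlift (pure v) = phi v.
Proof. by rewrite /tlift /pure lquot_liftE free_liftE. Qed.

End Lift.

Lemma tpow_ext (W : lmodType K) (f g : hom (tpow n V) W) :
  (forall v, f (pure v) = g (pure v)) -> f = g.
Proof.
move=> fg; apply: homP => t; have [x <-] := lquot_pi_surj t.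
rewrite -[x]freeg_sumE !linear_sum; apply: eq_bigr => v _.
rewrite (_ : << _ *g _ >> = coeff v x *: << v >>); last first.
  by apply/eqP/freeg_eqP => w; rewrite coeffZ !coeffU mul1r.
by rewrite !linearZ_LR; congr (_ *: _); exact: fg.
Qed.

End TensorPower.

Section EndomorphismOperad.
Context {K : fieldType} {V : lmodType K}.

Definition endo (n : nat) : lmodType K := hom (tpow n V) V.

Fact endo_unit_multilinear :
  multilinear (fun v : {ffun 'I_1 -> V} => v ord0).
Proof. by move=> v i a x y; rewrite !ffunE !ord1 eqxx. Qed.

(* id_V, under the identification of V^{(x) 1} with V. *)
Definition endo_unit : endo 1 := tlift endo_unit_multilinear.

Section Composition.
Context {k : nat} {n : 'I_k -> nat} (fs : forall i, endo (n i)).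

(* The i-th of the k consecutive blocks, of lengths n 0, ..., n (k-1). *)
Definition block (v : {ffun 'I_(\sum_i n i) -> V}) (i : 'I_k) : {ffun 'I_(n i) -> V} :=
  [ffun j => v (tagnat.Rank i j)].

Lemma block_upd v i (j : 'I_(n i)) x :
  block (upd v (tagnat.Rank i j) x) i = upd (block v i) j x.
Proof.
apply/ffunP => l; rewrite !ffunE -val_eqE /= tagnat.eq_Rank eqxx /=.
by rewrite val_eqE.
Qed.

Lemma block_upd_neq v i (j : 'I_(n i)) x i' :
  i' != i -> block (upd v (tagnat.Rank i j) x) i' = block v i'.
Proof.
move=> ii'; apply/ffunP => l.
by rewrite !ffunE -val_eqE /= tagnat.eq_Rank (negPf ii').
Qed.

Fact tensor_hom_multilinear :
  multilinear (fun v => pure [ffun i => fs i (pure (block v i))]).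
Proof.
move=> v l a x y; rewrite -(tagnat.sig2K l).
move: (tagnat.sig1 l) (tagnat.sig2 l) => i j.
have h z : [ffun i' => fs i' (pure (block (upd v (tagnat.Rank i j) z) i'))] =
    upd [ffun i' => fs i' (pure (block v i'))] i (fs i (pure (upd (block v i) j z))).
  apply/ffunP => i'; rewrite !ffunE; case: eqP => [->|/eqP ii'].
    by rewrite block_upd.
  by rewrite block_upd_neq.
by rewrite !h pure_multilinear linearP pure_multilinear.
Qed.

(* f_1 (x) ... (x) f_k *)
Definition tensor_hom : hom (tpow (\sum_i n i) V) (tpow k V) :=
  tlift tensor_hom_multilinear.

End Composition.

(* gamma (f; f_1, ..., f_k) *)
Definition endo_comp {k : nat} {n : 'I_k -> nat} (f : endo k)
    (fs : forall i, endo (n i)) : endo (\sum_i n i) :=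
  (f \o tensor_hom fs : {linear _ -> _}).

Lemma endo_compE k (n : 'I_k -> nat) (f : endo k) (fs : forall i, endo (n i)) v :
  endo_comp f fs (pure v) = f (pure [ffun i => fs i (pure (block v i))]).
Proof. apply: (congr1 f); exact: tliftE. Qed.

(* Arities start at 1: the value of P at 0 is irrelevant. *)
Definition suboperad (P : forall n, set (endo n)) : Prop :=
  [/\ forall n, (0 < n)%N -> subspace (P n),
      P 1 endo_unit &
      forall (k : nat) (n : 'I_k -> nat) (f : endo k) (fs : forall i, endo (n i)),
        (0 < k)%N -> (forall i, 0 < n i)%N ->
        P k f -> (forall i, P (n i) (fs i)) -> P (\sum_i n i)%N (endo_comp f fs)].

End EndomorphismOperad.
Arguments endo {K} V n.

Section IncidenceAlgebra.
Context (K : fieldType) {d : Order.disp_t} (Sigma : finPOrderType d).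

Definition comparable_pair : Type := {p : Sigma * Sigma | (p.1 <= p.2)%O}.
HB.instance Definition _ := Finite.on comparable_pair.

(* Vectors are given by their coordinates in the basis of pairs s <= t. *)
Definition incidence : Type := {ffun comparable_pair -> K^o}.
HB.instance Definition _ := GRing.Lmodule.on incidence.

Implicit Types (s t : Sigma) (f g h : incidence).

(* The basis vector (s, t) if s <= t, and 0 otherwise. *)
Definition incb s t : incidence := [ffun r => (val r == (s, t))%:R].

(* The bilinear extension of (s, s') (b, b') = (s, b') if s' = b, 0 otherwise. *)
Definition inc_mul f g : incidence :=
  \sum_p \sum_q
    (f p * g q) *: (if (val p).2 == (val q).1 then incb (val p).1 (val q).2 else 0).

Definition inc_one : incidence := \sum_s incb s s.

Lemma inc_sumE f : f = \sum_p f p *: incb (val p).1 (val p).2.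
Proof.
apply/ffunP => r; rewrite sum_ffunE (bigD1 r)//= big1 => [|q qr].
  by rewrite addr0 !ffunE -surjective_pairing eqxx /GRing.scale /= mulr1.
by rewrite !ffunE -surjective_pairing (inj_eq val_inj) eq_sym (negPf qr) scaler0.
Qed.

Fact inc_mulDl : left_distributive inc_mul +%R.
Proof.
move=> f g h; rewrite /inc_mul -big_split /=; apply: eq_bigr => p _.
rewrite -big_split /=; apply: eq_bigr => q _.
by rewrite !ffunE mulrDl scalerDl.
Qed.

Fact inc_mulDr : right_distributive inc_mul +%R.
Proof.
move=> f g h; rewrite /inc_mul -big_split /=; apply: eq_bigr => p _.
rewrite -big_split /=; apply: eq_bigr => q _.
by rewrite !ffunE mulrDr scalerDl.
Qed.

Lemma inc_scaleAl (a : K) f g : a *: inc_mul f g = inc_mul (a *: f) g.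
Proof.
rewrite /inc_mul scaler_sumr; apply: eq_bigr => p _.
rewrite scaler_sumr; apply: eq_bigr => q _.
by rewrite !ffunE scalerA mulrA.
Qed.

Lemma inc_scaleAr (a : K) f g : a *: inc_mul f g = inc_mul f (a *: g).
Proof.
rewrite /inc_mul scaler_sumr; apply: eq_bigr => p _.
rewrite scaler_sumr; apply: eq_bigr => q _.
by rewrite !ffunE scalerA mulrCA.
Qed.

Fact inc_mul0l f : inc_mul 0 f = 0.
Proof. by rewrite /inc_mul !big1// => p _; rewrite big1// => q _; rewrite ffunE mul0r scale0r. Qed.
Fact inc_mul0r f : inc_mul f 0 = 0.
Proof. by rewrite /inc_mul !big1// => p _; rewrite big1// => q _; rewrite ffunE mulr0 scale0r. Qed.

Fact inc_mul_suml (I : finType) (F : I -> incidence) g :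
  inc_mul (\sum_i F i) g = \sum_i inc_mul (F i) g.
Proof. exact: (big_morph (inc_mul^~ g) (fun f h => inc_mulDl f h g) (inc_mul0l g)). Qed.
Fact inc_mul_sumr (I : finType) (F : I -> incidence) g :
  inc_mul g (\sum_i F i) = \sum_i inc_mul g (F i).
Proof. exact: (big_morph (inc_mul g) (inc_mulDr g) (inc_mul0r g)). Qed.

Lemma incb_mul s s' b b' : (s <= s')%O -> (b <= b')%O ->
  inc_mul (incb s s') (incb b b') = if s' == b then incb s b' else 0.
Proof.
move=> ss' bb'; pose p : comparable_pair := exist _ (s, s') ss'.
pose q : comparable_pair := exist _ (b, b') bb'.
rewrite /inc_mul (bigD1 p)//= (bigD1 q)//= !ffunE !eqxx mulr1 scale1r.
rewrite !big1 ?addr0// => [p' p'p|q' q'q].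
  rewrite big1// => q' _; rewrite !ffunE (_ : val p' == _ = false).
    by rewrite mul0r scale0r.
  by apply: negbTE; apply: contra p'p => /eqP e; apply/eqP/val_inj.
rewrite !ffunE (_ : val q' == _ = false) ?mulr0 ?scale0r//.
by apply: negbTE; apply: contra q'q => /eqP e; apply/eqP/val_inj.
Qed.

Lemma inc_ind (P : incidence -> Prop) :
  P 0 -> (forall f g, P f -> P g -> P (f + g)) ->
  (forall a f, P f -> P (a *: f)) ->
  (forall s t, (s <= t)%O -> P (incb s t)) -> forall f, P f.
Proof.
move=> P0 PD PZ Pb f; rewrite [f]inc_sumE; apply: big_ind => // p _.
by apply: PZ; apply: Pb; exact: valP p.
Qed.

Fact inc_mulA : associative inc_mul.
Proof.
move=> f g h.
elim/inc_ind: f => [|f f' Hf Hf'|a f Hf|s s' ss'].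
- by rewrite !inc_mul0l.
- by rewrite !inc_mulDl Hf Hf'.
- by rewrite -!inc_scaleAl Hf.
elim/inc_ind: g => [|g g' Hg Hg'|a g Hg|b b' bb'].
- by rewrite inc_mul0r !inc_mul0l inc_mul0r.
- by rewrite !(inc_mulDl, inc_mulDr) Hg Hg'.
- by rewrite -!(inc_scaleAl, inc_scaleAr) Hg.
elim/inc_ind: h => [|h h' Hh Hh'|a h Hh|c c' cc'].
- by rewrite !inc_mul0r.
- by rewrite !inc_mulDr Hh Hh'.
- by rewrite -!inc_scaleAr Hh.
rewrite (incb_mul bb' cc') (incb_mul ss' bb').
have [e|ne] := eqVneq b' c; have [e'|ne'] := eqVneq s' b;
  rewrite ?inc_mul0l ?inc_mul0r//; subst.
- by rewrite !incb_mul ?eqxx// (le_trans ss', le_trans bb').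
- by rewrite incb_mul ?(negPf ne')// (le_trans bb').
- by rewrite incb_mul ?(negPf ne)// (le_trans ss').
Qed.

Fact inc_mul1l : left_id inc_one inc_mul.
Proof.
move=> f; elim/inc_ind: f => [|f f' Hf Hf'|a f Hf|s s' ss'].
- exact: inc_mul0r.
- by rewrite inc_mulDr Hf Hf'.
- by rewrite -inc_scaleAr Hf.
rewrite inc_mul_suml (bigD1 s)//= incb_mul// eqxx big1 ?addr0// => t ts.
by rewrite incb_mul// (negPf ts).
Qed.

Fact inc_mul1r : right_id inc_one inc_mul.
Proof.
move=> f; elim/inc_ind: f => [|f f' Hf Hf'|a f Hf|s s' ss'].
- exact: inc_mul0l.
- by rewrite inc_mulDl Hf Hf'.
- by rewrite -inc_scaleAl Hf.
rewrite inc_mul_sumr (bigD1 s')//= incb_mul// eqxx big1 ?addr0// => t ts.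
by rewrite incb_mul// eq_sym (negPf ts).
Qed.

(* Only a pzRingType, as incidence is the zero ring if Sigma is empty; together
   with inc_scaleAl and inc_scaleAr, a unital associative K-algebra. *)
HB.instance Definition _ := GRing.Zmodule_isPzRing.Build incidence
  inc_mulA inc_mul1l inc_mul1r inc_mulDl inc_mulDr.

Definition diag_subalg : set incidence := lspan (range (fun s => incb s s)).

End IncidenceAlgebra.
Arguments diag_subalg K {d} Sigma _.

Section BimoduleEndomorphisms.
Context {K : fieldType} {d : Order.disp_t} {Sigma : finPOrderType d}.
Local Notation I := (incidence K Sigma).
Local Notation S := (diag_subalg K Sigma).

Section Actions.
Context {n : nat} (s : I).

Fact lact_multilinear : multilinear
  (fun v : {ffun 'I_n -> I} =>
     pure [ffun j : 'I_n => if (j : nat) == 0%N then s * v j else v j]).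
Proof.
move=> v i a x y.
have h z : [ffun j : 'I_n => if (j : nat) == 0%N then s * upd v i z j else upd v i z j] =
  upd [ffun j : 'I_n => if (j : nat) == 0%N then s * v j else v j] i
      (if (i : nat) == 0%N then s * z else z).
  by apply/ffunP => j; rewrite !ffunE; case: (j =P i) => [->|].
rewrite !h; case: ifP => _; last exact: pure_multilinear.
by rewrite mulrDr -[s * (a *: x)]inc_scaleAr pure_multilinear.
Qed.

Fact ract_multilinear : multilinear
  (fun v : {ffun 'I_n -> I} => pure [ffun j : 'I_n => if j.+1 == n then v j * s else v j]).
Proof.
move=> v i a x y.
have h z : [ffun j : 'I_n => if j.+1 == n then upd v i z j * s else upd v i z j] =
  upd [ffun j : 'I_n => if j.+1 == n then v j * s else v j] i
      (if i.+1 == n then z * s else z).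
  by apply/ffunP => j; rewrite !ffunE; case: (j =P i) => [->|].
rewrite !h; case: ifP => _; last exact: pure_multilinear.
by rewrite mulrDl -[(a *: x) * s]inc_scaleAl pure_multilinear.
Qed.

(* Left multiplication by s on the first tensor factor, and right multiplication
   by s on the last one. *)
Definition lact : hom (tpow n I) (tpow n I) := tlift lact_multilinear.
Definition ract : hom (tpow n I) (tpow n I) := tlift ract_multilinear.

End Actions.

Definition bimodule_morphism {n : nat} (mu : endo I n) : Prop :=
  forall s x, S s -> mu (lact s x) = s * mu x /\ mu (ract s x) = mu x * s.

(* ... (x) v_i s (x) v_j (x) ... - ... (x) v_i (x) s v_j (x) ..., with j = i + 1. *)
Definition balance_rel (n : nat) : set (tpow n I) :=
  [set r | exists (v : {ffun 'I_n -> I}) (i j : 'I_n) (s : I),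
    [/\ j = i.+1 :> nat, S s &
        r = pure (upd v i (v i * s)) - pure (upd v j (s * v j))]].

(* The n-fold tensor product of I over S. *)
Definition tpowS (n : nat) : lmodType K := lquot (@balance_rel n).
Definition tpowS_proj (n : nat) : hom (tpow n I) (tpowS n) := lquot_pi (@balance_rel n).

Definition factorizes {n : nat} (mu : endo I n) : Prop :=
  exists nu : hom (tpowS n) I, forall x, mu x = nu (tpowS_proj n x).

End BimoduleEndomorphisms.

Definition End_IS (K : fieldType) (d : Order.disp_t) (Sigma : finPOrderType d)
    (n : nat) : set (endo (incidence K Sigma) n) :=
  [set mu | bimodule_morphism mu /\ factorizes mu].
Arguments End_IS K {d} Sigma n _.

(* Main.v *)
Require Import Defs.
From mathcomp Require Import all_boot all_order all_algebra.
From mathcomp Require Import classical_sets freeg.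

Set Implicit Arguments.
Unset Strict Implicit.
Unset Printing Implicit Defensive.

Import GRing.Theory.
Local Open Scope ring_scope.
Local Open Scope classical_set_scope.

(** Tested on pure tensors, membership of [mu] in [End_IS K Sigma n] amounts to
    three identities ([End_ISP]): for [s] in S,

    - left:    mu (s v_1, v_2, ..., v_n) = s mu (v_1, ..., v_n);
    - right:   mu (v_1, ..., v_n s) = mu (v_1, ..., v_n) s;
    - balance: mu (..., v_i s, v_{i+1}, ...) = mu (..., v_i, s v_{i+1}, ...).

    Each is linear in [mu], whence the subspaces, and the identity map satisfies
    them, balance being vacuous in arity 1.

    For a composite gamma (f; f_1, ..., f_k), the entries are cut into k
    consecutive blocks, and the first (last) entry is the first (last) entry of
    the first (last) block: the left (right) identity goes through f_1 (f_k),
    and then through f. For balance, either both entries lie in one block, and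
    the corresponding f_i is balanced, or s sits between two blocks. In that
    case the right identity of f_i and the left identity of f_{i+1} pull s out of
    the blocks, where balance of f carries it from one side to the other. This
    last case is why the bimodule condition and the factorization are needed
    together ([balanced_bilinear_comp]).

    The rest is the arithmetic of positions in a concatenation of nonempty
    blocks: [first_rankP], [last_rankP] and [consecutive_ranksP]. *)

(** * Tensor powers *)

Section TensorPowers.
Context {K : fieldType} {V : lmodType K}.

(** Pure tensors span, so a linear condition need only be checked on them. *)
Lemma tpow_pure_ind (n : nat) (P : set (tpow n V)) :
  subspace P -> (forall v, P (pure v)) -> forall x, P x.
Proof.
move=> [P0 PD] Ppure x; have [y <-] := lquot_pi_surj x.
rewrite -[y]freeg_sumE linear_sum.
apply: big_ind => // [a b Pa Pb|v _].
  by rewrite -[a]scale1r; exact: PD.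
rewrite (_ : << _ *g _ >> = coeff v y *: << v >>); last first.
  by apply/eqP/freeg_eqP => w; rewrite coeffZ !coeffU mul1r.
by rewrite linearZ_LR -[_ *: _]addr0; apply: PD => //; exact: Ppure.
Qed.

(** A composite reads each entry through a single block, so changing one entry of
    [v] changes one argument of the outer operation. *)
Lemma block_values_upd (k : nat) (n : 'I_k -> nat) (fs : forall i, endo V (n i))
    (v : {ffun 'I_(\sum_i n i) -> V}) i (j : 'I_(n i)) x :
  [ffun i' => fs i' (pure (block (upd v (tagnat.Rank i j) x) i'))] =
  upd [ffun i' => fs i' (pure (block v i'))] i
      (fs i (pure (upd (block v i) j x))).
Proof.
apply/ffunP => i'; rewrite !ffunE; case: eqP => [->|/eqP ii'].
  by rewrite block_upd.
by rewrite block_upd_neq.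
Qed.

End TensorPowers.

(** * Positions in a concatenation of blocks *)

Section Ranks.
Context {k : nat} {n : 'I_k -> nat}.

(** [\sum_(h < k | h < i) n h] is the position at which block [i] starts
    ([tagnat.RankEsum]); hence block [i.+1] starts where block [i] ends. *)
Lemma block_startS (i : 'I_k) :
  (\sum_(h < k | h < i.+1) n h = \sum_(h < k | h < i) n h + n i)%N.
Proof.
rewrite (bigD1 i) ?ltnSn //= addnC; congr (_ + _)%N.
by apply: eq_bigl => h; rewrite ltnS [in RHS]ltn_neqAle andbC.
Qed.

Hypothesis n_gt0 : forall i, (0 < n i)%N.

Variant first_rank_spec (l : 'I_(\sum_i n i)) : Prop :=
  FirstRank i (j : 'I_(n i)) of
    i = 0%N :> nat & j = 0%N :> nat & l = tagnat.Rank i j.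

(** Nonempty blocks matter here: an empty initial block would push position [0]
    into a later one. *)
Lemma first_rankP (l : 'I_(\sum_i n i)) : l = 0%N :> nat -> first_rank_spec l.
Proof.
rewrite -(tagnat.sig2K l); move: (tagnat.sig1 l) (tagnat.sig2 l) => i j.
rewrite tagnat.RankEsum => /eqP; rewrite addn_eq0 => /andP[/eqP s0 /eqP j0].
exists i j => //; case: (posnP i) => // i_gt0.
have k_gt0 := ltn_trans i_gt0 (ltn_ord i).
move: s0; rewrite (bigD1 (Ordinal k_gt0)) //= => /eqP.
by rewrite addn_eq0 eqn0Ngt n_gt0.
Qed.

Variant last_rank_spec (l : 'I_(\sum_i n i)) : Prop :=
  LastRank i (j : 'I_(n i)) of i.+1 = k & j.+1 = n i & l = tagnat.Rank i j.

Lemma last_rankP (l : 'I_(\sum_i n i)) :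
  l.+1 = (\sum_i n i)%N -> last_rank_spec l.
Proof.
rewrite -(tagnat.sig2K l); move: (tagnat.sig1 l) (tagnat.sig2 l) => i j.
rewrite tagnat.RankEsum -addnS [RHS](bigID (fun h : 'I_k => h < i.+1)%N) /=.
rewrite block_startS -addnA => /addnI e.
have j_last : j.+1 = n i.
  by apply/eqP; rewrite eqn_leq ltn_ord e leq_addr.
exists i j => //; apply/eqP; rewrite eqn_leq ltn_ord leqNgt /=.
apply/negP => lt_ik; move/eqP: e; rewrite j_last -[X in X == _]addn0 eqn_add2l.
by rewrite (bigD1 (Ordinal lt_ik)) /= ?ltnn // eq_sym addn_eq0 eqn0Ngt n_gt0.
Qed.

Variant consecutive_ranks_spec (l l' : 'I_(\sum_i n i)) : Prop :=
| SameBlock i (j j' : 'I_(n i)) of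
    j' = j.+1 :> nat & l = tagnat.Rank i j & l' = tagnat.Rank i j'
| AdjacentBlocks i i' (j : 'I_(n i)) (j' : 'I_(n i')) of
    i' = i.+1 :> nat & j.+1 = n i & j' = 0%N :> nat &
    l = tagnat.Rank i j & l' = tagnat.Rank i' j'.

(** Either the next position is still in block [i], or [j] was the last entry of
    its block and the next position starts block [i.+1], which is nonempty. *)
Lemma consecutive_ranksP (l l' : 'I_(\sum_i n i)) :
  l' = l.+1 :> nat -> consecutive_ranks_spec l l'.
Proof.
rewrite -(tagnat.sig2K l); move: (tagnat.sig1 l) (tagnat.sig2 l) => i j.
rewrite tagnat.RankEsum -addnS => e.
case: (ltnP j.+1 (n i)) => [lt_j|le_j].
  apply: (@SameBlock _ _ i j (Ordinal lt_j)) => //.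
  by apply: ord_inj; rewrite tagnat.RankEsum.
have ej : j.+1 = n i by apply/eqP; rewrite eqn_leq ltn_ord.
rewrite ej -block_startS in e.
have lt_i : (i.+1 < k)%N.
  rewrite ltnNge; apply/negP => le_k; have := ltn_ord l'; rewrite e.
  (* If block [i] were the last one, [l'] would be the total length. *)
  rewrite [X in (_ < X)%N](eq_bigl (fun h : 'I_k => h < i.+1)%N) ?ltnn //.
  by move=> h; rewrite (leq_trans (ltn_ord h)).
apply: (@AdjacentBlocks _ _ i (Ordinal lt_i) j (Ordinal (n_gt0 _))) => //.
by apply: ord_inj; rewrite tagnat.RankEsum addn0.
Qed.

End Ranks.

(** * Endomorphisms tested on pure tensors *)

Section BalancedEndomorphisms.
Context {K : fieldType} {d : Order.disp_t} {Sigma : finPOrderType d}.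
Local Notation I := (incidence K Sigma).
Local Notation S := (diag_subalg K Sigma).

Lemma lact_pure (n : nat) (v : {ffun 'I_n -> I}) (i : 'I_n) (s : I) :
  i = 0%N :> nat -> lact s (pure v) = pure (upd v i (s * v i)).
Proof.
move=> i0; rewrite /lact tliftE; congr pure; apply/ffunP => j.
by rewrite !ffunE -val_eqE /= i0; case: eqP => // j0; rewrite (_ : j = i) //;
  apply: ord_inj; rewrite i0.
Qed.

Lemma ract_pure (n : nat) (v : {ffun 'I_n -> I}) (i : 'I_n) (s : I) :
  i.+1 = n -> ract s (pure v) = pure (upd v i (v i * s)).
Proof.
move=> i_last; rewrite /ract tliftE; congr pure; apply/ffunP => j.
rewrite !ffunE -[X in _ == X]i_last eqSS val_eqE.
by case: eqP => [->|].
Qed.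

(** Positions enter through equations between natural numbers rather than through
    [ord0] and [ord_max], since the arity of a composite is a sum and not
    syntactically a successor. *)
Record balanced_bilinear (n : nat) (mu : endo I n) : Prop := BalancedBilinear {
  pure_left_linear : forall s v (i : 'I_n), S s -> i = 0%N :> nat ->
    mu (pure (upd v i (s * v i))) = s * mu (pure v);
  pure_right_linear : forall s v (i : 'I_n), S s -> i.+1 = n ->
    mu (pure (upd v i (v i * s))) = mu (pure v) * s;
  pure_balanced : forall s v (i j : 'I_n), S s -> j = i.+1 :> nat ->
    mu (pure (upd v i (v i * s))) = mu (pure (upd v j (s * v j))) }.

(** The universal property of the quotient by the balancing relations. *)
Lemma factorizesP (n : nat) (mu : endo I n) :
  factorizes mu <-> forall r, balance_rel r -> mu r = 0.
Proof.
split=> [[nu mu_nu] r rel_r|mu0].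
  have r0 : tpowS_proj n r = 0 by apply/lquot_pi_eq0; exact: sub_lspan.
  by rewrite mu_nu r0 raddf0.
by exists (lquot_lift mu0) => x; rewrite /tpowS_proj lquot_liftE.
Qed.

(** [mu] commutes with the action of [s] on a subspace of tensors, which is
    therefore everything as soon as it contains the pure tensors. *)
Lemma subspace_lact (n : nat) (mu : endo I n) (s : I) :
  subspace [set x | mu (lact s x) = s * mu x].
Proof.
rewrite /mkset; split=> [|a x y hx hy]; first by rewrite !raddf0 mulr0.
by rewrite !linearP hx hy mulrDr; congr (_ + _); exact: inc_scaleAr.
Qed.

Lemma subspace_ract (n : nat) (mu : endo I n) (s : I) :
  subspace [set x | mu (ract s x) = mu x * s].
Proof.
rewrite /mkset; split=> [|a x y hx hy]; first by rewrite !raddf0 mul0r.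
by rewrite !linearP hx hy mulrDl; congr (_ + _); exact: inc_scaleAl.
Qed.

Lemma End_ISP (n : nat) (mu : endo I n) :
  (0 < n)%N -> End_IS K Sigma n mu <-> balanced_bilinear mu.
Proof.
case: n mu => // n mu _; split=> [[mu_bim /factorizesP mu0]|[muL muR muB]].
  split=> [s v i Ss i0|s v i Ss i_last|s v i j Ss ij].
  - by rewrite -lact_pure //; case: (mu_bim s (pure v) Ss).
  - by rewrite -ract_pure //; case: (mu_bim s (pure v) Ss).
  - by apply/eqP; rewrite -subr_eq0 -raddfB; apply/eqP/mu0; exists v, i, j, s.
split=> [s x Ss|].
  split; move: x.
    apply: (tpow_pure_ind (subspace_lact mu s)) => v.
    by rewrite /mkset (lact_pure _ (i := ord0)) // muL.
  apply: (tpow_pure_ind (subspace_ract mu s)) => v.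
  by rewrite /mkset (ract_pure _ (i := ord_max)) // muR.
apply/factorizesP => _ [v [i [j [s [ij Ss ->]]]]].
by apply/eqP; rewrite raddfB subr_eq0; apply/eqP/muB.
Qed.

Lemma balanced_bilinear_subspace (n : nat) :
  subspace (@balanced_bilinear n).
Proof.
split=> [|a f g [fL fR fB] [gL gR gB]].
  by split=> *; rewrite !hom0E ?mulr0 ?mul0r.
split=> s v i.
- move=> Ss i0; rewrite !homDE !homZE fL // gL // mulrDr; congr (_ + _).
  exact: inc_scaleAr.
- move=> Ss i_last; rewrite !homDE !homZE fR // gR // mulrDl; congr (_ + _).
  exact: inc_scaleAl.
- by move=> j Ss ij; rewrite !homDE !homZE (fB s v i j) // (gB s v i j).
Qed.

Lemma balanced_bilinear_unit : balanced_bilinear (endo_unit : endo I 1).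
Proof.
split=> [s v i _ _|s v i _ _|s v i j _].
- by rewrite !tliftE ffunE (ord1 i) eqxx.
- by rewrite !tliftE ffunE (ord1 i) eqxx.
- by rewrite !ord1.
Qed.

(** An element of S acting at position [Rank i j] acts inside block [i], where the
    identities of [fs i] apply; at the ends of the block it leaves [fs i] and
    becomes a factor of the [i]-th argument of [f], where those of [f] apply. *)
Lemma balanced_bilinear_comp (k : nat) (n : 'I_k -> nat) (f : endo I k)
    (fs : forall i, endo I (n i)) :
  (forall i, 0 < n i)%N -> balanced_bilinear f ->
  (forall i, balanced_bilinear (fs i)) -> balanced_bilinear (endo_comp f fs).
Proof.
move=> n_gt0 [fL fR fB] fsP; split.
- move=> s v l Ss /(first_rankP n_gt0)[i j i0 j0 ->].
  rewrite !endo_compE block_values_upd.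
  have -> : v (tagnat.Rank i j) = block v i j by rewrite ffunE.
  by rewrite pure_left_linear // -(fL s _ i) // ffunE.
- move=> s v l Ss /(last_rankP n_gt0)[i j i_last j_last ->].
  rewrite !endo_compE block_values_upd.
  have -> : v (tagnat.Rank i j) = block v i j by rewrite ffunE.
  by rewrite pure_right_linear // -(fR s _ i) // ffunE.
move=> s v l l' Ss /(consecutive_ranksP n_gt0)[].
  move=> i j j' jj' -> ->; rewrite !endo_compE !block_values_upd.
  have vE h : v (tagnat.Rank i h) = block v i h by rewrite ffunE.
  by rewrite !vE (pure_balanced (fsP i) _ Ss jj').
(* The element [s] leaves block [i] on the right, crosses to the next argument
   of [f], and enters block [i'] on the left. *)
move=> i i' j j' ii' j_last j'0 -> ->; rewrite !endo_compE !block_values_upd.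
have vE h h' : v (tagnat.Rank h h') = block v h h' by rewrite ffunE.
rewrite !vE pure_right_linear // pure_left_linear //.
by have := fB s [ffun h => fs h (pure (block v h))] i i' Ss ii'; rewrite !ffunE.
Qed.

End BalancedEndomorphisms.

Theorem theorem5p6 (K : fieldType) (d : Order.disp_t) (Sigma : finPOrderType d) :
  suboperad (End_IS K Sigma).
Proof.
split=> [n n_gt0||k n f fs k_gt0 n_gt0 fP fsP].
- have [P0 PD] := @balanced_bilinear_subspace K d Sigma n.
  split=> [|a f g /(End_ISP _ n_gt0) fP /(End_ISP _ n_gt0) gP];
    apply/(End_ISP _ n_gt0) => //; exact: PD.
- by apply/End_ISP => //; exact: balanced_bilinear_unit.
- have sum_gt0 : (0 < \sum_i n i)%N.
    by rewrite (bigD1 (Ordinal k_gt0)) //= addn_gt0 n_gt0.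
  apply/(End_ISP _ sum_gt0)/balanced_bilinear_comp => // [|i].
    exact/(End_ISP _ k_gt0).
  exact/(End_ISP _ (n_gt0 i)).
Qed.
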